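(* Let $\mu\in\mathbb{R}$ and let $f$ be the probability density on $\mathbb{R}$ $$f(x)=\frac{(1+x^2)^{-\frac{3}{2}}\exp\left\{\mu\arctan x\right\}}{\int_{-\infty}^{+\infty}(1+y^2)^{-\frac{3}{2}}\exp\left\{\mu\arctan y\right\}\,dy},$$ which is the invariant density of the Pearson diffusion $dX_t=-\theta(X_t-\mu)\,dt+\sqrt{2\theta a(X_t^2+1)}\,dW_t$, $\theta>0$, with $a=1$. Then, for $m=1,2,\ldots$, $$\mathcal{R}_{\frac{2m+2}{3}}(f)=\frac{2m+2}{2m-1}\log\left(\frac{2}{1+\mu^2}\cosh\left(\frac{\mu\pi}{2}\right)\right)+\frac{3}{1-2m}\log\left(C(m,\mu)\sinh\left(\frac{(m+1)\mu}{3}\pi\right)\right),$$ where $$C(m,\mu)=\frac{2\,(2m)!}{\frac{(2m+2)\mu}{3}\prod_{k=1}^{m}\left(\left(\frac{(2m+2)\mu}{3}\right)^2+(2k)^2\right)},$$ and $$\mathcal{R}_{\frac{2m+3}{3}}(f)=\frac{2m+3}{2m}\log\left(\frac{2}{1+\mu^2}\cosh\left(\frac{\mu\pi}{2}\right)\right)-\frac{3}{2m}\log\left(D(m,\mu)\cosh\left(\frac{(2m+3)\mu}{6}\pi\right)\right),$$ where $$D(m,\mu)=\frac{2\,(2m+1)!}{\prod_{k=0}^{m}\left(\left(\frac{(2m+3)\mu}{3}\right)^2+(2k+1)^2\right)}.$$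
   Context: For a probability density $f$ on $\mathbb{R}$ and $\alpha>0$, $\alpha\neq1$, the Rényi information of order $\alpha$ is $$\mathcal R_\alpha(f)=\frac{1}{1-\alpha}\log\int_{-\infty}^{+\infty} f^\alpha(x)\,dx,$$ with $\log$ the natural logarithm. $W_t$ is a standard Wiener process. The invariant density of an ergodic diffusion $dX_t=b(X_t)\,dt+\sigma(X_t)\,dW_t$ on $(l,r)$ is $f(x)=m(x)/\int_l^r m(y)\,dy$, where $m(x)=1/(\sigma^2(x)s(x))$ and $s(x)=\exp\{-2\int_{\tilde x}^x b(y)/\sigma^2(y)\,dy\}$ for a fixed $\tilde x\in(l,r)$; here $f$ is given explicitly in the claim.
   Formalization: For μ=0 the constant C(m,μ) is undefined (division by zero), so the first formula is stated as written for μ≠0, and for μ=0 its right-hand side is read as its limit as the parameter tends to 0 through nonzero values. *)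

(* Defs.v *)
From HB Require Import structures.
From mathcomp Require Import all_boot all_order all_algebra.
From mathcomp Require Import all_classical all_reals all_analysis.

Set Implicit Arguments.
Unset Strict Implicit.
Unset Printing Implicit Defensive.

Import Order.TTheory GRing.Theory Num.Theory.
Import numFieldNormedType.Exports.

Local Open Scope classical_set_scope.
Local Open Scope ring_scope.

Definition sinh (R : realType) (x : R) : R := (expR x - expR (- x)) / 2.
Definition cosh (R : realType) (x : R) : R := (expR x + expR (- x)) / 2.

Definition is_probability_density (R : realType) (f : R -> R) : Prop :=
  [/\ measurable_fun setT f,
      forall x, 0 <= f x
    & (\int[lebesgue_measure]_x (f x)%:E = 1)%E].

(* Extended-real valued, so that an infinite or vanishing integral is not
   replaced by a default value.  Meant for [0 < alpha], [alpha != 1]. *)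
Definition renyi (R : realType) (alpha : R) (f : R -> R) : \bar R :=
  ((1 - alpha)^-1%:E *
   lne (\int[lebesgue_measure]_x (f x `^ alpha)%:E))%E.

(* Oriented integral from a to b. *)
Definition oriented_integral (R : realType) (a b : R) (g : R -> R) : R :=
  if a <= b then \int[lebesgue_measure]_(y in `[a, b]) g y
  else - \int[lebesgue_measure]_(y in `[b, a]) g y.

(* Diffusion dX = b(X) dt + sigma(X) dW, with base point x0. *)
Definition scale_density (R : realType) (b sigma : R -> R) (x0 x : R) : R :=
  expR (- 2 * oriented_integral x0 x (fun y => b y / sigma y ^+ 2)).

Definition speed_density (R : realType) (b sigma : R -> R) (x0 x : R) : R :=
  1 / (sigma x ^+ 2 * scale_density b sigma x0 x).

(* The open interval (l, r) with possibly infinite endpoints. *)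
Definition state_space (R : realType) (l r : \bar R) : set R :=
  [set x | (l < x%:E < r)%E].

(* The normalised speed density does not depend on the base point; the
   normalising integral is required to be positive and finite, since
   otherwise the real-valued integral below would be a default value. *)
Definition is_invariant_density (R : realType) (l r : \bar R)
    (b sigma : R -> R) (f : R -> R) : Prop :=
  forall x0, x0 \in state_space l r ->
    (0 < \int[lebesgue_measure]_(y in state_space l r)
           (speed_density b sigma x0 y)%:E < +oo)%E /\
    forall x, x \in state_space l r ->
      f x = speed_density b sigma x0 x /
            \int[lebesgue_measure]_(y in state_space l r)
              speed_density b sigma x0 y.

Definition pearson_drift (R : realType) (theta mu x : R) : R :=
  - theta * (x - mu).

Definition pearson_sigma (R : realType) (theta a x : R) : R :=
  Num.sqrt (2 * theta * a * (x ^+ 2 + 1)).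

Definition pearson_weight (R : realType) (mu x : R) : R :=
  (1 + x ^+ 2) `^ (- (3 / 2)) * expR (mu * atan x).

Definition pearson_density (R : realType) (mu x : R) : R :=
  pearson_weight mu x / \int[lebesgue_measure]_y pearson_weight mu y.

Definition Cconst (R : realType) (m : nat) (mu : R) : R :=
  (2 * ((2 * m)`!)%:R) /
  ((2 * m%:R + 2) * mu / 3 *
   \prod_(1 <= k < m.+1)
      (((2 * m%:R + 2) * mu / 3) ^+ 2 + (2 * k%:R) ^+ 2)).

Definition Dconst (R : realType) (m : nat) (mu : R) : R :=
  (2 * ((2 * m + 1)`!)%:R) /
  \prod_(0 <= k < m.+1)
     (((2 * m%:R + 3) * mu / 3) ^+ 2 + (2 * k%:R + 1) ^+ 2).

(* Main.v *)
(** Substituting [t = atan x] turns each integral in the theorem into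
    I(n, nu) = int_(-pi/2)^(pi/2) cos^n t exp(nu t) dt: the normalising constant
    is I(1, mu), and the integral of the alpha-th power of the unnormalised
    density is I(n, alpha mu) with n + 2 = 3 alpha.  Integrating by parts twice,
    (nu^2 + n^2) I(n, nu) = n (n - 1) I(n - 2, nu), which reduces I(n, nu) to
    I(0, nu) = 2 sinh(nu pi / 2) / nu or I(1, nu). *)
Require Import Defs.
From HB Require Import structures.
From mathcomp Require Import all_boot all_order all_algebra.
From mathcomp Require Import all_classical all_reals all_analysis.
From mathcomp Require Import measurable_realfun ring lra.

Import Order.TTheory GRing.Theory Num.Theory.
Import numFieldNormedType.Exports.

Local Open Scope classical_set_scope.
Local Open Scope ring_scope.

(** * Fundamental theorem of calculus on segments and on the whole line *)

Lemma is_derive_continuous {R : realType} (f F : R -> R) :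
  (forall x : R, is_derive x 1 F (f x)) -> continuous F.
Proof.
move=> dF x; apply/differentiable_continuous/derivable1_diffP.
by have [] := dF x.
Qed.

Lemma continuous_FTC2_is_derive {R : realType} (f F : R -> R) (a b : R) :
  a <= b -> continuous f -> (forall x : R, is_derive x 1 F (f x)) ->
  \int[lebesgue_measure]_(x in `[a, b]) f x = F b - F a.
Proof.
move=> ab cf dF; have cF := is_derive_continuous _ _ dF.
move: ab; rewrite le_eqVlt => /predU1P[->|ab].
  by rewrite set_itv1 Rintegral_set1 subrr.
rewrite /Rintegral (@continuous_FTC2 _ f F)//.
- exact: continuous_subspaceT.
- split.
  + by move=> x _; have [] := dF x.
  + by apply: cvg_at_right_filter; exact: cF.
  + by apply: cvg_at_left_filter; exact: cF.
- by move=> x _; rewrite derive1E; have [] := dF x.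
Qed.

(** The line is cut at 0 and the left half is reflected by [x => - x], with primitive [- F (- x)];
    each half is then an improper integral over [[0, +oo[]. Nonnegativity of [f] allows this without
    a separate proof of integrability. *)
Lemma ge0_continuous_FTC2T {R : realType} (f F : R -> R) (a b : R) :
  (forall x, 0 <= f x) -> continuous f ->
  (forall x : R, is_derive x 1 F (f x)) ->
  F x @[x --> -oo] --> a -> F x @[x --> +oo] --> b ->
  (\int[lebesgue_measure]_x (f x)%:E = (b - a)%:E)%E.
Proof.
move=> f0 cf dF Fa Fb; have cF := is_derive_continuous _ _ dF.
have mf : measurable_fun [set: R] f by exact: continuous_measurable_fun.
rewrite -{1}setC0 -(set_itvoc0 0%R) setCitv/= ge0_integral_setU//=; first last.
- rewrite disj_set2E; apply/eqP; rewrite -subset0 => x []/= /[!in_itv]/=.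
  by rewrite leNgt andbT => /negP.
- by move=> x _; rewrite lee_fin.
- by apply/measurable_EFinP; exact: measurable_funTS.
rewrite integral_itv_obnd_cbnd; last first.
  by apply/measurable_EFinP/measurable_funTS.
rewrite -{1}[0]oppr0 ge0_integration_by_substitutionNy//; last first.
  exact: continuous_subspaceT.
rewrite (@ge0_continuous_FTC2y _ f F 0 b)//; last 3 first.
- exact: continuous_subspaceT.
- by apply: cvg_at_right_filter; exact: cF.
- by move=> x _; rewrite derive1E; have [] := dF x.
have dFN (x : R) : is_derive x 1 (fun x => - F (- x)) (f (- x)).
  have := dF (- x) => dFx.
  by apply: is_derive_eq; ring.
rewrite (@ge0_continuous_FTC2y _ (f \o -%R) (fun x => - F (- x)) 0 (- a))//;
  last 5 first.
- by move=> x _; exact: f0.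
- apply: continuous_subspaceT => x.
  by apply: continuous_comp; [exact: opp_continuous|exact: cf].
- by apply: cvgN; move/cvgNy_compNP : Fa.
- by apply: cvg_at_right_filter; exact: (is_derive_continuous _ _ dFN).
- by move=> x _; rewrite derive1E; have [] := dFN x.
by rewrite -!EFinB -EFinD oppr0; congr EFin; ring.
Qed.

(** * The substitution [t = atan x] *)

Lemma cvgNy_atan {R : realType} : (@atan R) x @[x --> -oo] --> - (pi / 2).
Proof.
apply/cvgNy_compNP.
rewrite (_ : atan \o -%R = fun x : R => - atan x).
  by apply: cvgN; exact: cvgy_atan.
by apply/funext => x /=; rewrite atanN.
Qed.

(** Since [cos (atan x)] is [(1 + x ^+ 2)] to the power -1/2, one factor [1 / (1 + x ^+ 2)] is left
    over. It is the derivative of [atan], which the chain rule for [Q \o atan] produces. *)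
Lemma powR_cos_atan {R : realType} (n : nat) (x : R) :
  (1 + x ^+ 2) `^ (- ((n%:R + 2) / 2)) = cos (atan x) ^+ n / (1 + x ^+ 2).
Proof.
have x0 : 0 < 1 + x ^+ 2 by rewrite ltr_pwDl// sqr_ge0.
rewrite cos_atan -powR12_sqrt ?ltW// -powRN -(powR_mulrn n) ?powR_ge0//.
rewrite -powRrM -[in RHS](powR_inv1 (ltW x0)) -powRD ?(gt_eqF x0) ?implybT//.
by congr (_ `^ _); field.
Qed.

Lemma continuous_powR_exp_atan {R : realType} (n : nat) (nu : R) :
  continuous (fun x : R =>
    (1 + x ^+ 2) `^ (- ((n%:R + 2) / 2)) * expR (nu * atan x)).
Proof.
move=> x; under eq_fun do rewrite powR_cos_atan.
apply: cvgM.
  apply: cvgM.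
    apply: (@continuous_comp _ _ _ atan (fun t => cos t ^+ n)).
      exact: continuous_atan.
    apply: (@continuous_comp _ _ _ cos (fun t => t ^+ n)).
      exact: continuous_cos.
    exact: exprn_continuous.
  apply: cvgV; first by rewrite gt_eqF// ltr_pwDl// sqr_ge0.
  by apply: cvgD; [exact: cvg_cst|exact: exprn_continuous].
apply: (@continuous_comp _ _ _ (fun t => nu * atan t) expR); last first.
  exact: continuous_expR.
by apply: cvgM; [exact: cvg_cst|exact: continuous_atan].
Qed.

Lemma measurable_powR_exp_atan {R : realType} (n : nat) (nu : R) :
  measurable_fun setT (fun x : R =>
    (1 + x ^+ 2) `^ (- ((n%:R + 2) / 2)) * expR (nu * atan x)).
Proof.
by apply: continuous_measurable_fun; exact: continuous_powR_exp_atan.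
Qed.

(* I is the integral of cos^n t exp(nu t) over [-pi/2, pi/2].  Carrying the
   primitive Q gives the primitive Q \o atan on R, so no change of variables in
   integrals is needed. *)
Definition has_cos_exp_integral {R : realType} (n : nat) (nu I : R) : Prop :=
  exists2 Q : R -> R,
    forall t : R, is_derive t 1 Q (cos t ^+ n * expR (nu * t)) &
    Q (pi / 2) - Q (- (pi / 2)) = I.

(** By the mean value theorem, [I] is pi times the integrand at a point of the open interval, where
    the cosine is positive. This positivity later justifies the manipulations of logarithms. *)
Lemma has_cos_exp_integral_gt0 {R : realType} (n : nat) (nu I : R) :
  has_cos_exp_integral n nu I -> 0 < I.
Proof.
move=> [Q dQ <-]; have pi0 := pi_gt0 R.
have lt_pi : - (pi / 2) < pi / 2 :> R by lra.
have [] := MVT lt_pi (fun x _ => dQ x).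
  exact/continuous_subspaceT/is_derive_continuous.
move=> c /[!in_itv]/= cpi ->; rewrite mulr_gt0 ?subr_gt0//.
by rewrite mulr_gt0 ?expR_gt0// exprn_gt0// cos_gt0_pihalf.
Qed.

Lemma integral_powR_exp_atan {R : realType} (n : nat) (nu I : R) :
  has_cos_exp_integral n nu I ->
  (\int[lebesgue_measure]_x
     ((1 + x ^+ 2) `^ (- ((n%:R + 2) / 2)) * expR (nu * atan x))%:E = I%:E)%E.
Proof.
move=> [Q dQ <-]; have cQ := is_derive_continuous _ _ dQ.
apply: (@ge0_continuous_FTC2T _ _ (Q \o atan)).
- by move=> x; rewrite mulr_ge0 ?powR_ge0 ?expR_ge0.
- exact: continuous_powR_exp_atan.
- move=> x; have := dQ (atan x) => dQx.
  apply: is_derive_eq.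
  by rewrite powR_cos_atan /GRing.scale/=; ring.
- by apply: continuous_cvg; [exact: cQ|exact: cvgNy_atan].
- by apply: continuous_cvg; [exact: cQ|exact: cvgy_atan].
Qed.

(** * Recurrence and closed forms for I(n, nu) *)

Lemma has_cos_exp_integral_rec {R : realType} (n : nat) (nu I : R) :
  has_cos_exp_integral n nu I ->
  has_cos_exp_integral n.+2 nu
    ((n.+2%:R * n.+1%:R) / (nu ^+ 2 + n.+2%:R ^+ 2) * I).
Proof.
move=> [Q dQ QI].
have d0 : nu ^+ 2 + n.+2%:R ^+ 2 != 0.
  by rewrite gt_eqF// ltr_wpDl ?sqr_ge0// exprn_gt0.
(* With N = n + 2, the derivative of (nu cos^N t + N cos^(N-1) t sin t) exp(nu t) is ((nu^2 + N^2)
   cos^N t - N (N - 1) cos^(N-2) t) exp(nu t). Adding N (N - 1) Q cancels the second term. *)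
exists (fun t => ((nu * cos t ^+ n.+2 + n.+2%:R * (cos t ^+ n.+1 * sin t))
     * expR (nu * t) + n.+2%:R * n.+1%:R * Q t) / (nu ^+ 2 + n.+2%:R ^+ 2)).
- move=> t; have := dQ t => dQt.
  have dcX k : is_derive t 1 (fun x => cos x ^+ k.+1)
      (k.+1%:R * cos t ^+ k * - sin t).
    have := @is_deriveX _ _ cos k.+1 t 1 _ (is_derive_cos t).
    by rewrite exprfctE.
  have dce := dcX n.+1; have dco := dcX n.
  have de : is_derive t 1 (fun x => expR (nu * x)) (nu * expR (nu * t)).
    by apply: is_derive_eq; rewrite /GRing.scale/= mulr1 mulrC.
  apply: is_derive_eq.
  rewrite /GRing.scale/= !mulr0 add0r.
  (* The cross terms in cos^(N-1) t sin t have cancelled; [1 - sin t ^+ 2] is isolated so that it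
     can become [cos t ^+ 2]. *)
  transitivity ((nu ^+ 2 + n.+2%:R ^+ 2)^-1 * expR (nu * t) * cos t ^+ n *
    (nu ^+ 2 * cos t ^+ 2 + n.+2%:R * cos t ^+ 2
     + n.+2%:R * n.+1%:R * (1 - sin t ^+ 2))); first by rewrite !exprS; ring.
  rewrite -cos2sin2 !exprS; field.
  by move: d0; rewrite !expr2 -(add2n n) natrD.
(* The boundary terms vanish: each carries a positive power of the cosine, which is 0 at both
   ends. *)
- rewrite cosN sin_pihalf cos_pihalf !expr0n/= !(mulr0, mul0r, addr0, add0r).
  by rewrite -QI; ring.
Qed.

(** I(0, nu), the integral of exp(nu t) over [-pi/2, pi/2]. The value at 0, the length of the
    interval, fills the removable singularity. *)
Definition sinhc {R : realType} (nu : R) : R :=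
  if nu == 0 then pi else 2 * sinh (nu * pi / 2) / nu.

Lemma has_cos_exp_integral0 {R : realType} (nu : R) :
  has_cos_exp_integral 0 nu (sinhc nu).
Proof.
rewrite /sinhc; case: eqVneq => [->|nu0].
  exists id; last by lra.
  by move=> t; apply: is_derive_eq; rewrite mul0r expR0 mulr1.
exists (fun t => expR (nu * t) / nu).
  by move=> t; apply: is_derive_eq; rewrite /GRing.scale/=; field.
by rewrite /sinh mulrN mulrA; field.
Qed.

Lemma has_cos_exp_integral1 {R : realType} (nu : R) :
  has_cos_exp_integral 1 nu (2 / (1 + nu ^+ 2) * cosh (nu * pi / 2)).
Proof.
have d0 : 1 + nu ^+ 2 != 0 by rewrite gt_eqF// ltr_pwDl// sqr_ge0.
(* The primitive of the recurrence with N = 1, where the term in Q drops out because N (N - 1) =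
   0. *)
exists (fun t => (nu * cos t + sin t) * expR (nu * t) / (1 + nu ^+ 2)).
  move=> t; apply: is_derive_eq; rewrite /GRing.scale/= !(mulr0, add0r).
  by field; move: d0; rewrite expr2.
rewrite cosN sinN cos_pihalf sin_pihalf /cosh mulrN mulrA.
by field; move: d0; rewrite expr2.
Qed.

Lemma has_cos_exp_integral_even {R : realType} (m : nat) (nu : R) :
  has_cos_exp_integral (2 * m) nu
    (((2 * m)`!)%:R / \prod_(1 <= k < m.+1) (nu ^+ 2 + (2 * k%:R) ^+ 2)
     * sinhc nu).
Proof.
elim: m => [|m IH].
  rewrite muln0 big_geq// fact0 divr1 mul1r.
  exact: has_cos_exp_integral0.
have := has_cos_exp_integral_rec _ _ _ IH.
rewrite (_ : (2 * m).+2 = 2 * m.+1)%N; last by rewrite mulnS.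
congr has_cos_exp_integral; rewrite [in RHS]big_nat_recr//= invfM.
rewrite mulnS add2n !factS !natrM.
rewrite (_ : (2 * m).+2%:R = 2 * m.+1%:R :> R); first by ring.
by rewrite -natrM mulnS.
Qed.

(** Iterates the recurrence from I(1, nu). The product starts at [k = 0] because this base case
    already contributes the factor [nu ^+ 2 + 1]. *)
Lemma has_cos_exp_integral_odd {R : realType} (m : nat) (nu : R) :
  has_cos_exp_integral (2 * m + 1) nu
    (2 * ((2 * m + 1)`!)%:R
     / \prod_(0 <= k < m.+1) (nu ^+ 2 + (2 * k%:R + 1) ^+ 2)
     * cosh (nu * pi / 2)).
Proof.
elim: m => [|m IH].
  rewrite muln0 big_nat1 mulr0 add0r (_ : 1`! = 1)%N// mulr1 expr1n [nu ^+ 2 + 1]addrC.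
  exact: has_cos_exp_integral1.
have := has_cos_exp_integral_rec _ _ _ IH.
rewrite (_ : (2 * m + 1).+2 = 2 * m.+1 + 1)%N; last by rewrite mulnS.
congr has_cos_exp_integral; rewrite [in RHS]big_nat_recr//= invfM.
rewrite mulnS -addnA add2n !factS !natrM.
rewrite (_ : (2 * m + 1).+2%:R = 2 * m.+1%:R + 1 :> R); first by ring.
by rewrite -natrM natr1 mulnS addn1.
Qed.

(** Away from 0, [sinhc] is the difference quotient at 0 of [2 * sinh (nu * pi / 2)], whose
    derivative there is [pi]. *)
Lemma continuous_sinhc0 {R : realType} : {for 0, continuous (@sinhc R)}.
Proof.
apply/continuous_withinNx; rewrite [X in _ --> X]/sinhc eqxx.
have [dF <-] : is_derive (0 : R) 1 (fun nu => 2 * sinh (nu * pi / 2)) pi.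
  rewrite /sinh; apply: is_derive_eq.
  by rewrite /GRing.scale/= !mul0r oppr0 expR0; field.
apply: cvg_trans dF; apply: near_eq_cvg; near=> h => /=.
have h0 : h != 0 by near: h; exact: nbhs_dnbhs_neq.
rewrite /sinhc (negbTE h0) /shift/= addr0 scaler1 !mul0r /sinh oppr0 subrr.
by rewrite mul0r mulr0 subr0 /GRing.scale/= mulrC.
Unshelve. all: by end_near.
Qed.

(** * The normalised density and its Rényi information *)

Lemma integral_pearson_weight {R : realType} (mu : R) :
  (\int[lebesgue_measure]_x (pearson_weight mu x)%:E =
   (2 / (1 + mu ^+ 2) * cosh (mu * pi / 2))%:E)%E.
Proof.
rewrite -(integral_powR_exp_atan _ _ _ (has_cos_exp_integral1 mu)).
by apply: eq_integral => x _; rewrite /pearson_weight; congr (_ `^ _ * _)%:E; lra.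
Qed.

Lemma Rintegral_pearson_weight {R : realType} (mu : R) :
  \int[lebesgue_measure]_x pearson_weight mu x =
  2 / (1 + mu ^+ 2) * cosh (mu * pi / 2).
Proof. by rewrite /Rintegral integral_pearson_weight. Qed.

Lemma pearson_weight_gt0 {R : realType} (mu x : R) : 0 < pearson_weight mu x.
Proof.
by rewrite mulr_gt0 ?expR_gt0// powR_gt0// ltr_pwDl// sqr_ge0.
Qed.

Lemma measurable_pearson_weight {R : realType} (mu : R) :
  measurable_fun setT (pearson_weight mu).
Proof.
have := measurable_powR_exp_atan 1 mu.
by congr measurable_fun; apply/funext => x; congr (_ `^ _ * _); lra.
Qed.

Lemma is_probability_density_pearson {R : realType} (mu : R) :
  is_probability_density (pearson_density mu).
Proof.
have I0 := has_cos_exp_integral_gt0 _ _ _ (has_cos_exp_integral1 mu).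
rewrite /pearson_density; split.
- apply: measurable_funM => //; exact: measurable_pearson_weight.
- move=> x; rewrite Rintegral_pearson_weight.
  by rewrite divr_ge0 ?ltW ?pearson_weight_gt0.
- under eq_integral do rewrite EFinM.
  rewrite ge0_integralZr//.
  + rewrite integral_pearson_weight Rintegral_pearson_weight -EFinM.
    by rewrite divff// gt_eqF.
  + by apply/measurable_EFinP; exact: measurable_pearson_weight.
  + by move=> x _; rewrite lee_fin ltW ?pearson_weight_gt0.
  + by rewrite lee_fin invr_ge0 Rintegral_pearson_weight ltW.
Qed.

Lemma renyi_pearson {R : realType} (n : nat) (alpha mu I : R) :
  alpha * 3 = n%:R + 2 -> has_cos_exp_integral n (alpha * mu) I ->
  renyi alpha (pearson_density mu) =
  ((1 - alpha)^-1 *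
   (ln I - alpha * ln (2 / (1 + mu ^+ 2) * cosh (mu * pi / 2))))%:E.
Proof.
move=> an hI; have I0 := has_cos_exp_integral_gt0 _ _ _ hI.
have := has_cos_exp_integral_gt0 _ _ _ (has_cos_exp_integral1 mu).
rewrite /renyi /pearson_density Rintegral_pearson_weight.
move: (2 / _ * _) => J J0.
have -> : (\int[lebesgue_measure]_x ((pearson_weight mu x / J) `^ alpha)%:E =
           (I / J `^ alpha)%:E)%E.
  under eq_integral => x _.
    rewrite powRM ?invr_ge0 ?ltW ?pearson_weight_gt0//.
    rewrite -(powR_inv1 (ltW J0)) -powRrM mulN1r powRN.
    rewrite /pearson_weight powRM ?powR_ge0 ?expR_ge0//.
    rewrite -powRrM -expRM.
    (* The relation [alpha * 3 = n%:R + 2] turns the power of the weight into the exponent that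
       [powR_cos_atan] handles. *)
    rewrite (_ : - (3 / 2) * alpha = - ((n%:R + 2) / 2)); last by lra.
    rewrite (_ : mu * atan x * alpha = alpha * mu * atan x); last by ring.
    rewrite EFinM.
    over.
  rewrite ge0_integralZr//; last 3 first.
  + apply/measurable_EFinP; exact: measurable_powR_exp_atan.
  + by move=> x _; rewrite lee_fin mulr_ge0 ?powR_ge0 ?expR_ge0.
  + by rewrite lee_fin invr_ge0 powR_ge0.
  rewrite EFinM; congr (_ * _)%E; exact: integral_powR_exp_atan.
rewrite lne_EFin ?divr_gt0 ?powR_gt0// ln_div ?posrE ?powR_gt0// ln_powR.
by rewrite -EFinM.
Qed.

(** * The invariant density of the Pearson diffusion *)

Lemma oriented_integral_FTC2 {R : realType} (f F : R -> R) (a b : R) :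
  continuous f -> (forall x : R, is_derive x 1 F (f x)) ->
  oriented_integral a b f = F b - F a.
Proof.
move=> cf dF; rewrite /oriented_integral; case: (leP a b) => [|/ltW] ab.
  exact: continuous_FTC2_is_derive.
by rewrite (continuous_FTC2_is_derive _ F)// opprB.
Qed.

(** The base point and [theta] enter the speed density only through a multiplicative constant, which
    normalisation removes. *)
Lemma speed_density_pearson {R : realType} (theta mu x0 : R) : 0 < theta ->
  exists2 c : R, 0 < c &
    forall x, speed_density (pearson_drift theta mu) (pearson_sigma theta 1)
      x0 x = c * pearson_weight mu x.
Proof.
move=> theta0.
have d0 (x : R) : 0 < 1 + x ^+ 2 by rewrite ltr_pwDl// sqr_ge0.
have sigma2 x : pearson_sigma theta 1 x ^+ 2 = 2 * theta * (1 + x ^+ 2).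
  rewrite /pearson_sigma sqr_sqrtr; first by ring.
  by rewrite mulr1 addrC !mulr_ge0 ?ltW.
(* A primitive of drift over squared diffusion coefficient, in which [theta] cancels. The scale
   density is exp(-2 (G x - G x0)), whence the constant below. *)
pose G (x : R) := mu / 2 * atan x - ln (1 + x ^+ 2) / 4.
exists (expR (- (2 * G x0)) / (2 * theta)).
  by rewrite divr_gt0 ?expR_gt0// mulr_gt0.
move=> x; rewrite /speed_density /scale_density.
have -> : (fun y => pearson_drift theta mu y / pearson_sigma theta 1 y ^+ 2) =
          (fun y => (mu - y) / 2 / (1 + y ^+ 2)).
  apply/funext => y; rewrite sigma2 /pearson_drift.
  by field; rewrite !gt_eqF.
have dG (y : R) : is_derive y 1 G ((mu - y) / 2 / (1 + y ^+ 2)).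
  have := is_derive1_ln (d0 y) => dln.
  rewrite /G; apply: is_derive_eq.
  rewrite /GRing.scale/= !mulr0 add0r.
  by field; rewrite gt_eqF.
rewrite (oriented_integral_FTC2 _ G _ _ _ dG); last first.
  move=> y; apply: cvgM.
    by apply: cvgM; [apply: cvgB; [exact: cvg_cst|exact: cvg_id]|exact: cvg_cst].
  apply: cvgV; first by rewrite gt_eqF.
  by apply: cvgD; [exact: cvg_cst|exact: exprn_continuous].
rewrite sigma2 mulNr mulrBr opprB expRD /pearson_weight.
rewrite (_ : (1 + x ^+ 2) `^ _ = expR (- (ln (1 + x ^+ 2) / 2)) / (1 + x ^+ 2)).
  rewrite (_ : - (2 * G x) = - (mu * atan x - ln (1 + x ^+ 2) / 2)); last first.
    by rewrite /G; field.
  rewrite opprB [ln _ / 2 - _]addrC expRD !expRN.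
  by field; rewrite !gt_eqF ?expR_gt0.
(* The exponent -3/2 is -1/2 from exp(2 G) plus -1 from the squared diffusion coefficient. *)
rewrite -(powR_inv1 (ltW (d0 x))) (_ : - _ = - 2^-1 + -1); last by lra.
rewrite powRD ?(gt_eqF (d0 x)) ?implybT//; congr (_ * _).
by rewrite /powR (gt_eqF (d0 x)) mulNr mulrC.
Qed.

Lemma pearson_invariant_density {R : realType} (theta mu : R) : 0 < theta ->
  is_invariant_density -oo%E +oo%E
    (pearson_drift theta mu) (pearson_sigma theta 1) (pearson_density mu).
Proof.
move=> theta0 x0 _.
have -> : state_space -oo%E +oo%E = [set: R].
  by apply/seteqP; split => // x _; rewrite /state_space/= ltNyr ltry.
have [c c0 cE] := speed_density_pearson _ mu x0 theta0.
have J0 := has_cos_exp_integral_gt0 _ _ _ (has_cos_exp_integral1 mu).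
have int_speed : (\int[lebesgue_measure]_y
    (speed_density (pearson_drift theta mu) (pearson_sigma theta 1) x0 y)%:E =
    (c * (2 / (1 + mu ^+ 2) * cosh (mu * pi / 2)))%:E)%E.
  under eq_integral do rewrite cE EFinM.
  rewrite ge0_integralZl//.
  + by rewrite EFinM -integral_pearson_weight.
  + by apply/measurable_EFinP; exact: measurable_pearson_weight.
  + by move=> x _; rewrite lee_fin ltW ?pearson_weight_gt0.
  + by rewrite lee_fin ltW.
split; first by rewrite int_speed lte_fin mulr_gt0// ltry.
move=> x _; rewrite /Rintegral int_speed/= cE /pearson_density.
rewrite Rintegral_pearson_weight.
move: (2 / _ * _) J0 (pearson_weight mu x) => J J0 w.
by field; rewrite !gt_eqF.
Qed.

(** * Matching the constants C and D, and continuity in nu *)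

(** For nonzero [nu], the denominator of [sinhc] supplies the linear factor in the denominator of
    [Cconst]. *)
Lemma cos_exp_integral_even_Cconst {R : realType} (m : nat) (nu : R) : nu != 0 ->
  ((2 * m)`!)%:R / \prod_(1 <= k < m.+1)
     (((2 * m%:R + 2) / 3 * nu) ^+ 2 + (2 * k%:R) ^+ 2)
   * sinhc ((2 * m%:R + 2) / 3 * nu) =
  Cconst m nu * sinh ((m%:R + 1) * nu / 3 * pi).
Proof.
move=> nu0; have a0 : (2 * m%:R + 2) / 3 != 0 :> R.
  by rewrite gt_eqF// divr_gt0// ltr_wpDl.
rewrite /Cconst (_ : (2 * m%:R + 2) * nu / 3 = (2 * m%:R + 2) / 3 * nu); last first.
  by ring.
rewrite /sinhc mulf_eq0 (negbTE a0) (negbTE nu0)/=.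
rewrite (_ : _ * nu * pi / 2 = (m%:R + 1) * nu / 3 * pi); last by field.
by rewrite !invfM; ring.
Qed.

Lemma has_cos_exp_integral_Dconst {R : realType} (m : nat) (nu : R) :
  has_cos_exp_integral (2 * m + 1) ((2 * m%:R + 3) / 3 * nu)
    (Dconst m nu * cosh ((2 * m%:R + 3) * nu / 6 * pi)).
Proof.
have := has_cos_exp_integral_odd m ((2 * m%:R + 3) / 3 * nu).
rewrite /Dconst (_ : (2 * m%:R + 3) * nu / 3 = (2 * m%:R + 3) / 3 * nu); last first.
  by ring.
by rewrite (_ : _ * nu * pi / 2 = (2 * m%:R + 3) * nu / 6 * pi)//; field.
Qed.

Lemma continuous_even_cos_exp_integral0 {R : realType} (m : nat) (a : R) :
  {for 0, continuous (fun nu : R =>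
    ((2 * m)`!)%:R / \prod_(1 <= k < m.+1) ((a * nu) ^+ 2 + (2 * k%:R) ^+ 2)
    * sinhc (a * nu))}.
Proof.
have ca : a * nu @[nu --> (0 : R)] --> a * 0.
  by apply: cvgM; [exact: cvg_cst|exact: cvg_id].
apply: cvgM; last first.
  apply: continuous_cvg; last exact: ca.
  by rewrite mulr0; exact: continuous_sinhc0.
apply: cvgM; first exact: cvg_cst.
apply: cvgV.
  (* The product runs over [k >= 1], so at [nu = 0] each factor is [(2 * k%:R) ^+ 2], which is
     nonzero. *)
  rewrite prodf_seq_neq0; apply/allP => k; rewrite mem_index_iota => /andP[k0 _].
  by rewrite mulr0 expr0n add0r expf_neq0// mulf_neq0// pnatr_eq0 -lt0n.
apply: cvg_big => [|k _].
  exact: mul_continuous.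
apply: cvgD; last exact: cvg_cst.
exact: (cvgM ca ca).
Qed.

Lemma continuous_cos_exp_integral1 {R : realType} :
  continuous (fun nu : R => 2 / (1 + nu ^+ 2) * cosh (nu * pi / 2)).
Proof.
move=> x; apply: cvgM.
  apply: cvgM; first exact: cvg_cst.
  apply: cvgV; first by rewrite gt_eqF// ltr_pwDl// sqr_ge0.
  by apply: cvgD; [exact: cvg_cst|exact: exprn_continuous].
have cl : nu * pi / 2 @[nu --> x] --> x * pi / 2.
  by apply: cvgM; [apply: cvgM; [exact: cvg_id|exact: cvg_cst]|exact: cvg_cst].
apply: cvgM; last exact: cvg_cst.
apply: cvgD; apply: continuous_cvg; try exact: continuous_expR; first exact: cl.
exact: cvgN.
Qed.

Theorem theorem3p2 (R : realType) (mu : R) :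
  let f := pearson_density mu in
  is_probability_density f /\
  (forall theta : R, 0 < theta ->
     is_invariant_density -oo%E +oo%E
       (pearson_drift theta mu) (pearson_sigma theta 1) f) /\
  forall m : nat, (1 <= m)%N ->
    (* At nu = 0 the factor C(m, nu) * sinh (...) has the form 0/0 and is read
       as its limit. *)
    (let rhs (nu : R) : R :=
       (2 * m%:R + 2) / (2 * m%:R - 1)
         * ln (2 / (1 + nu ^+ 2) * cosh (nu * pi / 2))
       + 3 / (1 - 2 * m%:R)
         * ln (Cconst m nu * sinh ((m%:R + 1) * nu / 3 * pi)) in
     (mu != 0 -> renyi ((2 * m%:R + 2) / 3) f = (rhs mu)%:E) /\
     (mu = 0 ->
        (rhs nu)%:E @[nu --> mu^'] --> renyi ((2 * m%:R + 2) / 3) f)) /\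
    renyi ((2 * m%:R + 3) / 3) f =
      ((2 * m%:R + 3) / (2 * m%:R)
         * ln (2 / (1 + mu ^+ 2) * cosh (mu * pi / 2))
       - 3 / (2 * m%:R)
         * ln (Dconst m mu * cosh ((2 * m%:R + 3) * mu / 6 * pi)))%:E.
Proof.
move=> f; split; first exact: is_probability_density_pearson.
split=> [theta theta0|m m1]; first exact: pearson_invariant_density.
have m1R : 1 <= m%:R :> R by rewrite ler1n.
(* [a] is the even-case order, with 3 a = 2 m + 2, hence n = 2 m. Below, [even nu] is I(2m, a nu)
   and [J nu] is I(1, nu), both meaningful at [nu = 0] too. *)
pose a : R := (2 * m%:R + 2) / 3.
pose even nu := ((2 * m)`!)%:R /
  \prod_(1 <= k < m.+1) ((a * nu) ^+ 2 + (2 * k%:R) ^+ 2) * sinhc (a * nu).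
pose J (nu : R) := 2 / (1 + nu ^+ 2) * cosh (nu * pi / 2).
have hI nu : has_cos_exp_integral (2 * m) (a * nu) (even nu).
  exact: has_cos_exp_integral_even.
have even_renyi : renyi a f = ((1 - a)^-1 * (ln (even mu) - a * ln (J mu)))%:E.
  apply: renyi_pearson (hI mu).
  by rewrite /a natrM; field.
(* [1 - a] equals [(1 - 2 * m%:R) / 3], nonzero since [m >= 1]. *)
have coef1 : - ((1 - a)^-1 * a) = (2 * m%:R + 2) / (2 * m%:R - 1).
  by rewrite /a; field; apply/andP; split; lra.
have coef2 : (1 - a)^-1 = 3 / (1 - 2 * m%:R).
  by rewrite /a; field; lra.
split; last first.
  rewrite (renyi_pearson _ _ _ _ _ (has_cos_exp_integral_Dconst m mu)); last first.
    by rewrite natrD natrM; field.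
  congr EFin; move: (ln _) (ln _) => x y.
  by field; apply/andP; split; lra.
move=> rhs.
have rhsE nu : nu != 0 -> rhs nu = (1 - a)^-1 * (ln (even nu) - a * ln (J nu)).
  move=> nu0; rewrite /rhs -coef1 -coef2 -cos_exp_integral_even_Cconst//.
  by rewrite -/a -/(even nu) -/(J nu); ring.
split=> [mu0|mu0]; first by rewrite even_renyi rhsE.
rewrite even_renyi.
(* For [mu = 0], the expression in [even] and [J] is continuous at 0 and agrees with [rhs] on the
   punctured neighbourhood, so its value at 0 is the limit of [rhs]. *)
have : ((1 - a)^-1 * (ln (even nu) - a * ln (J nu)))%:E @[nu --> mu^'] -->
       ((1 - a)^-1 * (ln (even mu) - a * ln (J mu)))%:E.
  have J_cvg : J nu @[nu --> mu^'] --> J mu.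
    by apply: cvg_within_filter; exact: continuous_cos_exp_integral1.
  have even_cvg : even nu @[nu --> mu^'] --> even mu.
    rewrite mu0; apply: cvg_within_filter.
    exact: continuous_even_cos_exp_integral0.
  apply: cvg_EFin; first exact: nearW.
  apply: cvgM; first exact: cvg_cst.
  apply: cvgB.
    apply: continuous_cvg; last exact: even_cvg.
    (* The logarithm is continuous at [even mu] because that value is a positive integral. *)
    exact/continuous_ln/has_cos_exp_integral_gt0.
  apply: cvgM; first exact: cvg_cst.
  apply: continuous_cvg; last exact: J_cvg.
  exact/continuous_ln/has_cos_exp_integral_gt0/has_cos_exp_integral1.
apply: cvg_trans; apply: near_eq_cvg; near=> nu.
by rewrite rhsE//; rewrite -mu0; near: nu; exact: nbhs_dnbhs_neq.
Unshelve. all: by end_near.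
Qed.
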